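(* There exist constants $C>0$ and $c>0$ such that for every sleep rate $\lambda\in(0,1)$, every positive integer $N$, and every (deterministic) initial configuration $\eta_0\in\{0,1,2,\dots\}^{\mathcal{B}_N}$ of active particles in $\mathcal{B}_N$ with $\sum_{x\in\mathcal{B}_N}\eta_0(x)\le|\mathcal{B}_N|$, the number $S(\mathcal{B}_N)$ of sleeping particles in $\mathcal{B}_N$ after stabilization of the finite-volume Activated Random Walk dynamics on $\mathcal{B}_N$ started from $\eta_0$ satisfies $$\mathbb{P}\left(S(\mathcal{B}_N)\ge\frac{C}{\ln(1/\lambda)}|\mathcal{B}_N|\right)\le e^{-cN^2}.$$
   Context: For a positive integer $N$, $\mathcal{B}_N:=\{-N,\dots,N\}^2\subset\mathbb{Z}^2$, and $|\mathcal{B}_N|$ is its cardinality. Write $x\sim y$ if $x,y\in\mathbb{Z}^2$ are nearest neighbors. Finite-volume Activated Random Walk dynamics on $\mathcal{B}_N$ with sleep rate $\lambda$: configurations are elements $\eta\in\{0,\mathfrak{s},1,2,\dots\}^{\mathcal{B}_N}$, where $\eta(x)=k\in\{0,1,2,\dots\}$ means that there are $k$ particles at $x$, all active, and $\eta(x)=\mathfrak{s}$ means that there is exactly one particle at $x$ and it is sleeping; order the values by $0<\mathfrak{s}<1<2<\cdots$, and set $\mathfrak{s}+1=2$. The process $(\eta_t)_{t\ge0}$ is the continuous-time Markov chain in which, for each $x\in\mathcal{B}_N$ with $\eta_{t-}(x)\ge1$: - for each of the four neighbors $y\sim x$ in $\mathbb{Z}^2$, at rate $\frac14\eta_{t-}(x)$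 a particle moves from $x$ to $y$, i.e. $\eta(x)$ is replaced by $\eta(x)-1$ and, if $y\in\mathcal{B}_N$, $\eta(y)$ is replaced by $\eta(y)+1$ (so a sleeping particle at $y$ is reactivated); if $y\notin\mathcal{B}_N$, the particle is killed (removed); - at rate $\lambda\eta_{t-}(x)$ a sleep instruction is performed at $x$: if $\eta_{t-}(x)=1$ then $\eta(x)$ becomes $\mathfrak{s}$, and otherwise nothing changes. The dynamics eventually (almost surely) stabilizes, i.e. reaches a configuration in which all particles remaining in $\mathcal{B}_N$ are sleeping; $S(\mathcal{B}_N)$ denotes the number of sleeping particles in $\mathcal{B}_N$ in this final configuration. *)

(* Defs.v *)
From HB Require Import structures.
From mathcomp Require Import all_boot all_order all_algebra.
From mathcomp Require Import all_classical all_reals all_analysis.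
Set Implicit Arguments.
Unset Strict Implicit.
Unset Printing Implicit Defensive.
Import Order.TTheory GRing.Theory Num.Theory.
Import numFieldNormedType.Exports.

Local Open Scope classical_set_scope.
Local Open Scope ring_scope.

(* Continuous-time Markov chains on a discrete state space E.  The matrix G   *)
(* is the generator, diagonal included: G i i = - \sum_(j != i) G i j.        *)

Section markov_chain.
Context {R : realType} {d : measure_display} {T : measurableType d}.
Context {E : choiceType}.
Variables (P : probability T R) (X : R -> T -> E).

(* P(X_(t+h) = j | history, X_t = i) = P(X_(t+h) = j | X_t = i), multiplied   *)
(* out so as to be meaningful when the conditioning events are null; the      *)
(* history is an arbitrary finite list of pairs (u, k) read as X_u = k.       *)
Definition markov_property :=
  forall (past : seq (R * E)) (t h : R) (i j : E),
    0 <= h -> (forall p, p \in past -> 0 <= p.1 <= t) -> 0 <= t ->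
    let past_event := [set w | forall p, p \in past -> X p.1 w = p.2] in
    let now := [set w | X t w = i] in
    let next := [set w | X (t + h) w = j] in
    (P (past_event `&` now `&` next) * P now =
     P (past_event `&` now) * P (now `&` next))%E.

(* P(X_(t+h) = j | X_t = i) = (i == j) + G i j * h + o(h) as h -> 0+,         *)
(* uniformly in t, multiplied by P(X_t = i).                                  *)
Definition has_generator (G : E -> E -> R) :=
  forall (i j : E) (e : R), 0 < e ->
    exists2 delta : R, 0 < delta & forall t h : R, 0 <= t -> 0 < h < delta ->
      `|fine (P [set w | X t w = i /\ X (t + h) w = j])
        - fine (P [set w | X t w = i]) * ((i == j)%:R + G i j * h)|
      <= e * h * fine (P [set w | X t w = i]).

(* Only the values X t for t >= 0 are constrained. *)
Definition is_markov_chain (G : E -> E -> R) (x0 : E) :=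
  [/\ forall t i, 0 <= t -> measurable [set w | X t w = i],
      forall w t, 0 <= t -> exists2 e : R, 0 < e &
        forall s, t <= s < t + e -> X s w = X t w,
      P [set w | X 0 w = x0] = 1%E,
      markov_property
    & has_generator G].

End markov_chain.

(* [Active k]: k active particles (k = 0: empty site);                        *)
(* [Sleeping]: exactly one particle, asleep.                                  *)
Inductive site := Active of nat | Sleeping.

Definition site_code (s : site) : option nat :=
  if s is Active k then Some k else None.
Definition site_decode (o : option nat) : site :=
  if o is Some k then Active k else Sleeping.
Lemma site_codeK : cancel site_code site_decode. Proof. by case. Qed.
HB.instance Definition _ := Countable.copy site (can_type site_codeK).

Definition nactive (s : site) : nat := if s is Active k then k else 0%N.

Definition add_particle (s : site) : site :=
  if s is Active k then Active k.+1 else Active 2.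

(* Only ever used on sites with at least one active particle. *)
Definition remove_particle (s : site) : site :=
  if s is Active k then Active k.-1 else Sleeping.

Definition fall_asleep (s : site) : site :=
  if s is Active 1 then Sleeping else s.

(* The box {-N, ..., N}^2; [coord] is its embedding in Z^2. *)
Definition box (N : nat) := ('I_(N.*2.+1) * 'I_(N.*2.+1))%type.

Definition coord (N : nat) (x : box N) : int * int :=
  ((x.1 : nat)%:Z - N%:Z, (x.2 : nat)%:Z - N%:Z).

Definition unit_steps : seq (int * int) :=
  [:: (1, 0); (-1, 0); (0, 1); (0, -1)].

Definition config (N : nat) := {ffun box N -> site}.

Definition all_active (N : nat) (n : {ffun box N -> nat}) : config N :=
  [ffun x => Active (n x)].

(* If coord x + e is outside of the box, no site matches the second test and  *)
(* the particle is killed.                                                    *)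
Definition move (N : nat) (x : box N) (e : int * int) (eta : config N) :
    config N :=
  [ffun z => if z == x then remove_particle (eta z)
             else if coord z == coord x + e then add_particle (eta z)
             else eta z].

Definition sleep (N : nat) (x : box N) (eta : config N) : config N :=
  [ffun z => if z == x then fall_asleep (eta z) else eta z].

(* Entry (eta, xi) of the generator L of the dynamics, i.e. (L f)(eta) for f  *)
(* the indicator function of xi, where L f (eta) is the sum over the possible *)
(* transitions eta -> eta' of rate * (f eta' - f eta).  Transitions with the  *)
(* same target add up, and those with eta' = eta do not contribute.           *)
Definition arw_generator {R : realType} (N : nat) (lambda : R)
    (eta xi : config N) : R :=
  \sum_(x : box N)
    ((\sum_(e <- unit_steps)
        (nactive (eta x))%:R / 4 * ((move x e eta == xi)%:R - (eta == xi)%:R))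
     + lambda * (nactive (eta x))%:R
         * ((sleep x eta == xi)%:R - (eta == xi)%:R)).

Definition stable (N : nat) (eta : config N) : bool :=
  [forall x, nactive (eta x) == 0%N].

Definition num_sleeping (N : nat) (eta : config N) : nat :=
  #|[pred x | eta x == Sleeping]|.

Definition stabilizes_to {R : realType} (N : nat) (path : R -> config N)
    (xi : config N) : Prop :=
  stable xi /\ exists2 t0 : R, 0 <= t0 & forall t, t0 <= t -> path t = xi.

(* The number of sleeping particles in the final configuration.  A path which *)
(* never stabilizes (an event of probability 0 for the dynamics) is given the *)
(* empty configuration by convention.                                         *)
Definition final_sleeping {R : realType} (N : nat) (path : R -> config N) :
    nat :=
  num_sleeping
    (xget [ffun=> Active 0] [set xi | stabilizes_to path xi]).

(* Main.v *)
Require Import Defs.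
From HB Require Import structures.
From mathcomp Require Import all_boot all_order all_algebra.
From mathcomp Require Import all_classical all_reals all_analysis.
From mathcomp Require Import ring lra zify.
Set Implicit Arguments.
Unset Strict Implicit.
Unset Printing Implicit Defensive.
Import Order.TTheory GRing.Theory Num.Theory.
Import numFieldNormedType.Exports.

Local Open Scope classical_set_scope.
Local Open Scope ring_scope.

(* Think of a stack of instructions at each site.  If the final sleeping set  *)
(* is A and m x jumps occur at x, then (i) the jumps balance the initial      *)
(* configuration against 1_A, and (ii) at each x in A the instruction after   *)
(* the m x-th jump is a sleep, of probability at most lambda, independently   *)
(* of (i).  The expected number of m satisfying (i), legal or not, is at most *)
(* 1 / det(I - P) <= 4^|B_N|, P being the walk killed outside of B_N.  Hence  *)
(* P(A) <= lambda^|A| 4^|B_N|, and summing over the sets A,                   *)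
(* E[lambda^(-S(B_N))] <= 8^|B_N|; Markov's inequality with C = 4 concludes.  *)
(* As the chain comes without stacks, the bound is read off a superharmonic   *)
(* function of the configuration, built from the Green functions              *)
(* G_X(v) = sum over m supported in X of P(m balances v), which satisfy       *)
(* G_X = D_x G_X + G_(X - x), D_x averaging over one jump from x in X.        *)

(** The bound on the exponential moment of the number of sleepers comes from the supermartingale
    [lyapunov], a sum over target sets A and frozen sets S of lambda^(-|S|) G_(~S)(occupation -
    1_A). Averaging over a jump from an active x lowers each term by G_(~S - x), by the first-jump
    identity [green_limE]. If x falls asleep, the sets x |: S become admissible when x is in A;
    their extra weight 1/lambda, times the sleep rate lambda, gives back at most that loss. This is
    [lyapunov_superharmonic]. The bound G_X <= 4^|X| ([green_enum_le]) makes the initial value at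
    most 8^|B_N| ([lyapunov_all_active]); since G_X(0) >= 1, the value at a stable configuration is
    at least lambda^(-number of sleepers) ([lyapunov_stable]). To transfer this to the chain, mass
    never increases, so the dynamics stays in a finite set of configurations, on which
    [superharmonic_expectation_le] integrates the generator inequality over small time steps.
    Markov's inequality at integer times ([measure_settled_le]) and a monotone limit
    ([final_sleeping_settled]) finish the proof. *)

Definition jump (N : nat) (x : box N) (e : int * int) : {ffun box N -> int} :=
  [ffun z : box N => (Defs.coord z == Defs.coord x + e)%:Z - (z == x)%:Z].

(** * Green functions with a bounded number of jumps *)

Section green.
Context {R : realType} {N : nat}.
Local Notation vec := {ffun box N -> int}.
Implicit Types (v : vec) (x y : box N) (l : seq (box N)) (F : vec -> R).

Definition spread x F v : R := \sum_(e <- unit_steps) F (v + jump x e) / 4.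

Lemma spreadD x F1 F2 v :
  spread x (fun u => F1 u + F2 u) v = spread x F1 v + spread x F2 v.
Proof. by rewrite /spread -big_split; apply: eq_bigr => e _; rewrite mulrDl. Qed.

Lemma spreadC x y F v : spread x (spread y F) v = spread y (spread x F) v.
Proof.
rewrite /spread.
under eq_bigr do rewrite big_distrl.
under [RHS]eq_bigr do rewrite big_distrl.
rewrite exchange_big; apply: eq_bigr => e _; apply: eq_bigr => f _.
by rewrite -!addrA (addrC (jump y e)).
Qed.

Lemma ler_spread x F1 F2 v : (forall u, F1 u <= F2 u) ->
  spread x F1 v <= spread x F2 v.
Proof. by move=> le12; apply: ler_sum => e _; rewrite ler_wpM2r. Qed.

Lemma spread_cst x (c : R) v : spread x (fun=> c) v = c.
Proof. by rewrite /spread /unit_steps !big_cons big_nil; field. Qed.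

Lemma spread_ge0 x F v : (forall u, 0 <= F u) -> 0 <= spread x F v.
Proof. by move=> F0; apply: sumr_ge0 => e _; rewrite divr_ge0. Qed.

(* green l J v is the sum of P(m jumps from the sites of l, m x of them from  *)
(* x, bring v to 0) over the m : l -> nat with total at most J; v is a signed *)
(* vector and x may be negative in it: jumps need not be legal.               *)
Fixpoint green l : nat -> vec -> R :=
  if l is x :: l' then
    fix g J := if J is J'.+1 then fun v => spread x (g J') v + green l' J v
               else fun v => (v == 0)%:R
  else fun _ v => (v == 0)%:R.

Lemma green0 l v : green l 0 v = (v == 0)%:R. Proof. by case: l. Qed.

Lemma green_consS x l J v :
  green (x :: l) J.+1 v = spread x (green (x :: l) J) v + green l J.+1 v.
Proof. by []. Qed.

(** The order in which sites are listed is irrelevant because averages over jumps from different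
    sites commute ([spreadC]). *)
Lemma green_cons_swap x y l : green (x :: y :: l) = green (y :: x :: l).
Proof.
(* Unfolding level [J.+2] twice reaches both [J.+1] and [J], hence an induction on two consecutive
   levels. *)
suff swap J : green (x :: y :: l) J = green (y :: x :: l) J /\
    green (x :: y :: l) J.+1 = green (y :: x :: l) J.+1.
  by apply/funext => J; have [] := swap J.
elim: J => [|J [IH0 IH1]]; split => //; apply/funext => v.
  by rewrite !green_consS !addrA [X in X + _]addrC.
rewrite !(green_consS _ (_ :: _)) ![green (_ :: l) J.+2 _]green_consS !addrA.
congr (_ + _).
(* On each side the averaged function is rewritten with the other site at the head, so that both
   sides reach the double average at level [J]. *)
rewrite -IH1 {1}IH1.
rewrite [in LHS](_ : green (y :: x :: l) J.+1 = fun u =>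
  spread y (green (y :: x :: l) J) u + green (x :: l) J.+1 u)//.
rewrite [in RHS](_ : green (x :: y :: l) J.+1 = fun u =>
  spread x (green (x :: y :: l) J) u + green (y :: l) J.+1 u)//.
by rewrite !spreadD IH0 spreadC addrAC.
Qed.

(** Any site of [l] can be brought to the head, so the first-jump decomposition holds at all of
    them. *)
Lemma green_rem x l J v : x \in l ->
  green l J.+1 v = spread x (green l J) v + green (rem x l) J.+1 v.
Proof.
move=> xl; suff -> : green l = green (x :: rem x l) by rewrite green_consS.
elim: l xl => [//|y l IH]; rewrite inE.
have [-> _|xy xl] := eqVneq x y; first by rewrite /= eqxx.
have -> : rem x (y :: l) = y :: rem x l by rewrite /= eq_sym (negbTE xy).
have cons_ext l1 l2 : green l1 = green l2 -> green (y :: l1) = green (y :: l2).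
  by move=> /= ->.
by rewrite (cons_ext _ _ (IH xl)) green_cons_swap.
Qed.

Lemma green_ge0 l J v : 0 <= green l J v.
Proof.
elim: l J v => [|x l IHl] J v //=.
elim: J v => [|J IHJ] v //.
by rewrite addr_ge0 ?spread_ge0 ?IHl.
Qed.

Lemma green_nondecreasing l v : nondecreasing_seq (green l ^~ v).
Proof.
apply/nondecreasing_seqP => J.
elim: l J v => [|x l IHl] J v //.
elim: J v => [|J IHJ] v; rewrite [leRHS]green_consS.
  rewrite green0 -(green0 l) ler_wpDl ?IHl// spread_ge0// => u; exact: green_ge0.
by rewrite green_consS lerD ?IHl// ler_spread.
Qed.

(** Jumps from other sites only add particles at [y], so a positive entry there can never be
    cleared. *)
Lemma green_notin l J v y : y \notin l -> 0 < v y -> green l J v = 0.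
Proof.
elim: l J v => [|x l IHl] J v.
  by move=> _ vy /=; case: eqP vy => // ->; rewrite ffunE.
rewrite inE negb_or => /andP[yx yl].
elim: J v => [|J IHJ] v vy.
  by rewrite green0; case: eqP vy => // ->; rewrite ffunE.
rewrite green_consS IHl// addr0 /spread big1// => e _.
by rewrite IHJ ?mul0r// !ffunE (negbTE yx) subr0 ltr_wpDr.
Qed.

Lemma sum_jump x e :
  \sum_z jump x e z = [exists z : box N, Defs.coord z == Defs.coord x + e]%:Z - 1.
Proof.
have coord_inj : injective (@Defs.coord N).
  move=> [a b] [a' b'] [] /addIr[aa'] /addIr[bb'].
  by congr pair; apply: val_inj.
under eq_bigr do rewrite ffunE.
rewrite big_split /= sumrN; congr (_ - _); last first.
  by rewrite (bigD1 x)//= eqxx big1 ?addr0// => z /negbTE ->.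
case: existsP => [[z0 /eqP z0E]|nz].
  rewrite (bigD1 z0)//= z0E eqxx big1 ?addr0// => z zz0.
  by rewrite -z0E (inj_eq coord_inj) (negbTE zz0).
by rewrite big1// => z _; case: eqP => // /eqP zE; case: nz; exists z.
Qed.

(** A jump preserves the total or, when the particle is killed, lowers it by one; a negative total
    never returns to 0. *)
Lemma green_sum_lt0 l J v : \sum_z v z < 0 -> green l J v = 0.
Proof.
have delta0 (w : vec) : \sum_z w z < 0 -> (w == 0)%:R = 0 :> R.
  by case: eqP => // ->; under eq_bigr do rewrite ffunE; rewrite big1.
elim: l J v => [|x l IHl] J v; first exact: delta0.
elim: J v => [|J IHJ] v v0; first by rewrite green0 delta0.
rewrite green_consS IHl// addr0 /spread big1// => e _.
rewrite IHJ ?mul0r//; under eq_bigr do rewrite ffunE.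
by rewrite big_split /= sum_jump -[ltRHS]addr0 ltr_leD// subr_le0 lez_nat leq_b1.
Qed.

(* While some site y has v y > 0, it must be emptied, so its first jump can be *)
(* averaged over; a nonzero v without such a site has too few particles.      *)
Lemma green_le_at0 l J v : uniq l -> green l J v <= green l J 0.
Proof.
move=> ul; elim: J v => [|J IHJ] v; first by rewrite !green0 eqxx ler_nat leq_b1.
have [/existsP[y vy]|] := boolP [exists y, 0 < v y].
  have [yl|yl] := boolP (y \in l); last by rewrite (green_notin _ yl)// green_ge0.
  rewrite (green_rem _ _ yl) (@green_notin (rem y l) _ _ y) ?mem_rem_uniqF//.
  rewrite addr0 (le_trans _ (green_nondecreasing l 0 (leqnSn J)))//.
  by rewrite -[leRHS](spread_cst y _ v) ler_spread.
rewrite negb_exists => /forallP v0.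
have [->//|vn0] := eqVneq v 0.
rewrite green_sum_lt0 ?green_ge0//.
have [y vy] : exists y, v y != 0.
  by apply/existsP; apply: contraNT vn0; rewrite negb_exists => /forallP w0;
     apply/eqP/ffunP => y; rewrite ffunE; apply/eqP; have:= w0 y; rewrite negbK.
rewrite (bigD1 y)//= -[ltRHS]addr0 ltr_leD//; first by have := v0 y; lia.
by apply: sumr_le0 => z _; have := v0 z; lia.
Qed.

End green.

(** * The limiting Green functions and their uniform bound *)

Section green_limit.
Context {R : realType} {N : nat}.
Local Notation vec := {ffun box N -> int}.
Implicit Types (v : vec) (x : box N) (X : {set box N}).

Lemma rem_enum x X : rem x (enum X) = enum (X :\ x).
Proof.
rewrite rem_filter ?enum_uniq// /enum_mem -filter_predI.
by apply: eq_filter => z /=; rewrite !inE.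
Qed.

(* A rightmost site x of X sends a particle with probability 1/4 out of X, from *)
(* where it cannot return, so adding x to X costs a factor at most 4.         *)
Lemma green_enum_le X J v : green (enum X) J v <= 4 ^+ #|X| :> R.
Proof.
apply: (le_trans (green_le_at0 _ _ (enum_uniq _))).
elim: {X}#|X| {-2}X (erefl #|X|) J => [|n IHn] X Xn J.
  by rewrite Xn (cards0_eq Xn) enum_set0 /= eqxx.
have [x0 x0X] : exists x0, x0 \in X by apply/set0Pn; rewrite -card_gt0 Xn.
case: (@arg_maxnP _ x0 (mem X) (fun x => x.1 : nat) x0X) => x /= xX xmax.
have XxE : #|X :\ x| = n by have := cardsD1 x X; rewrite Xn xX => -[].
move: J => [|J]; first by rewrite green0 eqxx exprn_ege1// ler1n.
(* The particle sent to the right either lands in the box at a site outside [X], since [x] is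
   rightmost, or is killed and leaves a negative total. *)
have right0 : green (enum X) J (0 + jump x (1, 0)) = 0 :> R.
  have [/existsP[z /eqP zE]|nz] :=
    boolP [exists z : box N, Defs.coord z == Defs.coord x + (1, 0)].
    have z1 : z.1 = x.1.+1 :> nat.
      have /(congr1 fst) /= := zE. lia.
    have zx : z != x by apply: contra_eq_neq z1 => ->; rewrite neq_ltn ltnSn.
    apply: (@green_notin _ _ _ _ _ z); rewrite ?mem_enum.
      by apply/negP => /xmax; rewrite z1 ltnn.
    by rewrite !ffunE zE eqxx (negbTE zx).
  apply: green_sum_lt0; under eq_bigr do rewrite ffunE.
  rewrite big_split /= sum_jump (negbTE nz) big1// => z _.
  by rewrite ffunE.
have other e : green (enum X) J (0 + jump x e) <= green (enum X) J.+1 0 :> R.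
  apply: le_trans (green_le_at0 _ _ (enum_uniq _)) _.
  exact: green_nondecreasing.
have := IHn _ XxE J.+1; rewrite XxE => IH.
have := @green_rem R N x (enum X) J 0; rewrite mem_enum => /(_ xX).
rewrite rem_enum /spread /unit_steps !big_cons big_nil right0.
(* The three other directions give g <= 3/4 g + 4^n for g the value at level [J.+1], that is g <=
   4^(n+1). *)
have := other (-1, 0); have := other (0, 1); have := other (0, -1).
rewrite Xn exprS; lra.
Qed.

Definition green_lim X v : R := limn (fun J => green (enum X) J v).

Lemma cvg_green X v : green (enum X) J v @[J --> \oo] --> green_lim X v.
Proof.
apply: nondecreasing_is_cvgn; first exact: green_nondecreasing.
by exists (4 ^+ #|X|) => _ [J _ <-]; exact: green_enum_le.
Qed.

Lemma green_lim_ge0 X v : 0 <= green_lim X v.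
Proof.
by apply: limr_ge (cvgP _ (@cvg_green X v)) _; near=> J; exact: green_ge0.
Unshelve. all: by end_near. Qed.

Lemma green_lim_le X v : green_lim X v <= 4 ^+ #|X|.
Proof.
by apply: limr_le (cvgP _ (@cvg_green X v)) _; near=> J; exact: green_enum_le.
Unshelve. all: by end_near. Qed.

(** The empty family of jumps already balances 0. *)
Lemma green_lim_ge1 X : 1 <= green_lim X 0.
Proof.
apply: limr_ge (cvgP _ (@cvg_green X 0)) _; near=> J.
rewrite (le_trans _ (green_nondecreasing _ _ (leq0n J)))//.
by rewrite green0 eqxx.
Unshelve. all: by end_near. Qed.

(** In [green_rem] the two sides sit at levels [J.+1] and [J]; the limit removes this mismatch. *)
Lemma green_limE x X v : x \in X ->
  green_lim X v = spread x (green_lim X) v + green_lim (X :\ x) v.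
Proof.
move=> xX.
have shift (Y : {set box N}) (u : vec) :
    green (enum Y) J.+1 u @[J --> \oo] --> green_lim Y u.
  by rewrite (cvg_shiftS (fun J => green (enum Y) J u)); exact: cvg_green.
have := shift X v.
under eq_fun do rewrite (@green_rem _ _ x) ?mem_enum// rem_enum.
move/(cvg_unique _); apply => //; apply: cvgD (shift _ _).
rewrite /spread /unit_steps !big_cons big_nil.
under eq_fun do rewrite !big_cons big_nil.
by do !apply: cvgD; first [exact: cvg_cst | exact: cvgMl (@cvg_green _ _)].
Qed.

End green_limit.

Definition nparticles (s : site) : nat := if s is Active k then k else 1.

(** * The superharmonic function of the configuration *)

Section lyapunov.
Context {R : realType} {N : nat}.
Local Notation vec := {ffun box N -> int}.
Implicit Types (x : box N) (e : int * int) (eta : config N) (A S : {set box N}).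

Definition occupation eta : vec := [ffun x => (nparticles (eta x))%:Z].

Definition asleep eta : {set box N} := [set x | eta x == Sleeping].

Lemma occupation_move x e eta : (0 < nactive (eta x))%N -> e != 0 ->
  occupation (Defs.move x e eta) = occupation eta + jump x e.
Proof.
move=> xact e0; apply/ffunP => z; rewrite !ffunE.
case: (eqVneq z x) => [->|zx].
  rewrite -{1}[Defs.coord x]addr0 (inj_eq (addrI _)) eq_sym (negbTE e0).
  by case: (eta x) xact => [[|k]|] //= _; lia.
case: ifP => _; rewrite subr0 ?addr0//.
by case: (eta z) => [k|] //=; rewrite -PoszD addn1.
Qed.

Lemma asleep_move x e eta : asleep (Defs.move x e eta) \subset asleep eta.
Proof.
apply/fintype.subsetP => z; rewrite !inE ffunE.
by case: ifP => _; [|case: ifP => _ //]; case: (eta z).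
Qed.

Lemma sleepE x eta : (0 < nactive (eta x))%N ->
  Defs.sleep x eta = eta \/
  occupation (Defs.sleep x eta) = occupation eta /\
  asleep (Defs.sleep x eta) = x |: asleep eta.
Proof.
case etax : (eta x) => [[|[|k]]|] // _; [right|left].
- split; [apply/ffunP|apply/finset.setP] => z; rewrite ?inE !ffunE;
    by case: (eqVneq z x) => // ->; rewrite etax.
- by apply/ffunP => z; rewrite ffunE; case: (eqVneq z x) => // ->; rewrite etax.
Qed.

(* A is the set of sites on which the final configuration sleeps and S the    *)
(* set of already sleeping sites which are never visited again: each site of  *)
(* A \ S still needs a sleep instruction right after its last jump.  Summing  *)
(* over A bounds all the final configurations at once.                        *)
Definition lyapunov (lambda : R) eta : R :=
  \sum_(A : {set box N}) \sum_(S : {set box N} | S \subset A :&: asleep eta)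
    lambda^-1 ^+ #|S| *
    green_lim (~: S) (occupation eta - [ffun x : box N => (x \in A)%:Z]).

Lemma lyapunov_ge0 (lambda : R) eta : 0 < lambda -> 0 <= lyapunov lambda eta.
Proof.
move=> l0; apply: sumr_ge0 => A _; apply: sumr_ge0 => S _.
by rewrite mulr_ge0 ?green_lim_ge0// exprn_ge0 ?invr_ge0 ?ltW.
Qed.

(** Without sleepers only the empty S is admissible, and each of the 2^|B_N| sets A contributes at
    most 4^|B_N|. *)
Lemma lyapunov_all_active (lambda : R) (n : {ffun box N -> nat}) :
  lyapunov lambda (all_active n) <= 8 ^+ #|{: box N}|.
Proof.
rewrite /lyapunov.
have -> : asleep (all_active n) = finset.set0.
  by apply/finset.setP => z; rewrite !inE ffunE.
have -> : 8 = 4 * 2 :> R by ring.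
have pow2 : 2 ^+ #|{: box N}| = #|powerset [set: box N]|%:R :> R.
  by rewrite card_powerset cardsT natrX.
rewrite exprMn pow2 mulr_natr -sumr_const.
rewrite [leRHS](eq_bigl xpredT); last by move=> A; rewrite !inE finset.subsetT.
apply: ler_sum => A _.
rewrite (big_pred1 finset.set0) => [|S]; last by rewrite finset.setI0 finset.subset0.
rewrite cards0 expr0 mul1r finset.setC0.
by rewrite (le_trans (green_lim_le _ _))// cardsT.
Qed.

(** The single term with A and S both equal to the sleeping set suffices: its Green function is
    evaluated at 0. *)
Lemma lyapunov_stable (lambda : R) eta : 0 < lambda -> stable eta ->
  lambda^-1 ^+ num_sleeping eta <= lyapunov lambda eta.
Proof.
move=> l0 /forallP stab.
have ge0 A S : 0 <= lambda^-1 ^+ #|S| *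
    green_lim (~: S) (occupation eta - [ffun x : box N => (x \in A)%:Z]).
  by rewrite mulr_ge0 ?green_lim_ge0// exprn_ge0 ?invr_ge0 ?ltW.
rewrite /lyapunov (bigD1 (asleep eta))//= ler_wpDr//.
  by apply: sumr_ge0 => A _; apply: sumr_ge0.
rewrite (bigD1 (asleep eta))/= ?finset.setIid// ler_wpDr//; first exact: sumr_ge0.
have -> : #|asleep eta| = num_sleeping eta by apply: eq_card => z; rewrite !inE.
rewrite [X in green_lim _ X](_ : _ = 0).
  by rewrite ler_peMr ?green_lim_ge1// exprn_ge0// invr_ge0 ltW.
apply/ffunP => z; rewrite !ffunE inE.
by have := stab z; case: (eta z) => [k|] //= /eqP ->.
Qed.

Lemma sum_subset_setU1 x (D : {set box N}) (f : {set box N} -> R) : x \notin D ->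
  \sum_(S : {set box N} | S \subset x |: D) f S =
  \sum_(S : {set box N} | S \subset D) (f S + f (x |: S)).
Proof.
move=> xD; rewrite big_split (bigID (fun S : {set box N} => x \in S)) /= addrC.
congr (_ + _).
  apply: eq_bigl => S; apply/andP/idP => [[/fintype.subsetP SxD xS]|SD].
    apply/fintype.subsetP => z zS; have := SxD z zS; rewrite !inE => /orP[/eqP zx|//].
    by rewrite zx in zS; rewrite zS in xS.
  split; first exact: fintype.subset_trans SD (finset.subsetUr _ _).
  by apply: contra xD; apply: fintype.subsetP.
rewrite (reindex_onto (fun S => x |: S) (fun S => S :\ x)) /=; last first.
  by move=> S /andP[_ xS]; rewrite finset.setD1K.
apply: eq_bigl => S; rewrite finset.setU11 andbT.
apply/andP/idP => [[SxD /eqP SE]|SD].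
  by rewrite -SE finset.subDset.
split; first by rewrite finset.setUS.
by rewrite finset.setU1K//; apply: contra xD; apply: fintype.subsetP.
Qed.

Lemma lyapunov_superharmonic (lambda : R) x eta : 0 < lambda ->
  (0 < nactive (eta x))%N ->
  \sum_(e <- unit_steps)
    (lyapunov lambda (Defs.move x e eta) - lyapunov lambda eta) / 4 +
  lambda * (lyapunov lambda (Defs.sleep x eta) - lyapunov lambda eta) <= 0.
Proof.
move=> l0 xact.
pose v A := occupation eta - [ffun x : box N => (x \in A)%:Z].
pose c S : R := lambda^-1 ^+ #|S|.
have c0 S : 0 <= c S by rewrite exprn_ge0 ?invr_ge0 ?ltW.
(* A jump may wake a sleeper, which only removes sets S from a sum of nonnegative terms. *)
have moveE e : e \in unit_steps -> lyapunov lambda (Defs.move x e eta) <=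
    \sum_(A : {set box N}) \sum_(S : {set box N} | S \subset A :&: asleep eta)
      c S * green_lim (~: S) (v A + jump x e).
  move=> eunit; apply: ler_sum => A _.
  rewrite occupation_move//; last by move: eunit; rewrite !inE => /or4P[] /eqP ->.
  rewrite addrAC [leRHS](bigID
    (fun S : {set box N} => S \subset A :&: asleep (Defs.move x e eta))) /=.
  rewrite ler_wpDr ?sumr_ge0// => [S _|]; first by rewrite mulr_ge0 ?green_lim_ge0.
  rewrite le_eqVlt; apply/orP; left; apply/eqP; apply: eq_bigl => S.
  rewrite andb_idl// => SA; apply: fintype.subset_trans SA _.
  by rewrite finset.setIS ?asleep_move.
(* Only a lone particle at [x] in [A] yields a gain: the new sets are [x |: S], and the factor
   [lambda] cancels their extra weight. *)
have sleepxE : lambda * (lyapunov lambda (Defs.sleep x eta) - lyapunov lambda eta) <=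
    \sum_(A : {set box N}) \sum_(S : {set box N} | S \subset A :&: asleep eta)
      c S * green_lim (~: S :\ x) (v A).
  case: (sleepE xact) => [->|[occE asleepE]].
    rewrite subrr mulr0; apply: sumr_ge0 => A _; apply: sumr_ge0 => S _.
    by rewrite mulr_ge0 ?green_lim_ge0.
  rewrite /lyapunov occE asleepE -sumrB big_distrr /=; apply: ler_sum => A _.
  have [xA|xA] := boolP (x \in A); last first.
    rewrite (_ : A :&: (x |: asleep eta) = A :&: asleep eta); last first.
      by apply/finset.setP => z; rewrite !inE; case: eqP => // ->; rewrite (negbTE xA).
    rewrite subrr mulr0; apply: sumr_ge0 => S _.
    by rewrite mulr_ge0 ?green_lim_ge0.
  rewrite (_ : A :&: (x |: asleep eta) = x |: (A :&: asleep eta)); last first.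
    by apply/finset.setP => z; rewrite !inE; case: eqP => // ->; rewrite xA.
  have xD : x \notin A :&: asleep eta.
    by rewrite !inE; case: eqP xact => [->|]; rewrite ?andbF.
  rewrite sum_subset_setU1// big_split/=.
  rewrite addrAC subrr add0r big_distrr /=.
  apply: ler_sum => S SD.
  rewrite mulrA cardsU1 (_ : x \notin S) ?exprS; last first.
    by apply: contra xD; apply: fintype.subsetP.
  rewrite mulrA mulfV ?gt_eqF// mul1r.
  rewrite (_ : ~: (x |: S) = ~: S :\ x)//.
  by apply/finset.setP => z; rewrite !inE negb_or.
have movesE : \sum_(e <- unit_steps)
      (lyapunov lambda (Defs.move x e eta) - lyapunov lambda eta) / 4 <=
    \sum_(e <- unit_steps)
      (\sum_(A : {set box N}) \sum_(S : {set box N} | S \subset A :&: asleep eta)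
        c S * green_lim (~: S) (v A + jump x e) - lyapunov lambda eta) / 4.
  rewrite big_seq [leRHS]big_seq; apply: ler_sum => e eunit.
  by rewrite ler_wpM2r// lerB// moveE.
apply: le_trans (lerD movesE sleepxE) _.
under eq_bigr do rewrite /lyapunov -sumrB big_distrl /=.
rewrite exchange_big /= -big_split /=; apply: sumr_le0 => A _.
under eq_bigr do rewrite -sumrB big_distrl /=.
rewrite exchange_big /= -big_split /=; apply: sumr_le0 => S SD.
(* An active site is not frozen, so [green_limE] applies at [x] and the loss by jumps cancels the
   bound on the gain by sleep, term by term. *)
have xS : x \in ~: S.
  rewrite inE; apply/negP => /(fintype.subsetP SD); rewrite !inE => /andP[_ /eqP sx].
  by rewrite sx in xact.
under eq_bigr do rewrite -mulrBr -mulrA.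
rewrite -big_distrr /= -mulrDr mulr_ge0_le0//.
rewrite (green_limE _ xS) /spread.
rewrite /unit_steps !big_cons !big_nil -/(v A).
lra.
Qed.

End lyapunov.

(** * From the generator inequality to expectations *)

Section supermartingale.
Context {R : realType} {d : measure_display} {T : measurableType d}.
Context {E : choiceType}.
Variables (P : probability T R) (X : R -> T -> E) (G : E -> E -> R) (x0 : E).
Implicit Types (F : seq E).

Lemma sum_fiber_le (Y : T -> E) F (B : set T) :
  (forall i, measurable [set w | Y w = i]) -> measurable B -> uniq F ->
  \sum_(i <- F) fine (P (B `&` [set w | Y w = i])) <= fine (P B).
Proof.
move=> mY; elim: F B => [|a F IH] B mB.
  by rewrite big_nil fine_ge0.
move=> /= /andP[aF uF]; rewrite big_cons.
rewrite (measureDI P mB (mY a)) fineD ?fin_num_measure//; last 2 first.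
- exact: measurableD.
- exact: measurableI.
rewrite addrC lerD2r; apply: le_trans (IH _ (measurableD mB (mY a)) uF).
rewrite le_eqVlt; apply/orP; left; apply/eqP.
apply: eq_big_seq => i iF; congr (fine (P _)); apply/seteqP; split=> w [].
  by move=> Bw Yi; split=> //; split=> // Ya; move: aF; rewrite -Ya Yi iF.
by move=> [].
Qed.

Lemma has_generator_uniform F (e : R) : has_generator P X G -> 0 < e ->
  exists2 delta : R, 0 < delta & forall i j, i \in F -> j \in F ->
    forall t h : R, 0 <= t -> 0 < h < delta ->
      `|fine (P [set w | X t w = i /\ X (t + h) w = j])
        - fine (P [set w | X t w = i]) * ((i == j)%:R + G i j * h)|
      <= e * h * fine (P [set w | X t w = i]).
Proof.
move=> gen e0.
pose Q (p : E * E) (delta : R) := forall t h : R, 0 <= t -> 0 < h < delta ->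
      `|fine (P [set w | X t w = p.1 /\ X (t + h) w = p.2])
        - fine (P [set w | X t w = p.1]) * ((p.1 == p.2)%:R + G p.1 p.2 * h)|
      <= e * h * fine (P [set w | X t w = p.1]).
have all_seq (s : seq (E * E)) : exists2 delta : R, 0 < delta &
    forall p, p \in s -> Q p delta.
  elim: s => [|p s [delta delta0 sdelta]]; first by exists 1.
  have [delta' delta'0 pdelta'] := gen p.1 p.2 e e0.
  exists (Num.min delta delta'); first by rewrite lt_min delta0.
  move=> q; rewrite inE => /orP[/eqP ->|qs] t h t0 /andP[h0];
    rewrite lt_min => /andP[hd hd'].
    by apply: pdelta'; rewrite ?h0.
  by apply: sdelta; rewrite ?h0.
have [delta delta0 Hdelta] := all_seq [seq (i, j) | i <- F, j <- F].
exists delta => // i j iF jF; apply: (Hdelta (i, j)).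
by apply/allpairsP; exists (i, j).
Qed.

(** As [psi] is nonnegative on [F], dropping the trajectories outside [F] at time [t] keeps a lower
    bound. The step [delta] does not depend on [t], which allows iteration. *)
Lemma subharmonic_increment F (psi : E -> R) (e : R) :
  is_markov_chain P X G x0 -> uniq F ->
  (forall i, i \in F -> 0 <= psi i) ->
  (forall i, i \in F -> 0 <= \sum_(j <- F) G i j * psi j) ->
  0 < e ->
  exists2 delta : R, 0 < delta & forall t h : R, 0 <= t -> 0 < h < delta ->
    \sum_(i <- F) fine (P [set w | X t w = i]) * psi i - e * h <=
    \sum_(i <- F) fine (P [set w | X (t + h) w = i]) * psi i.
Proof.
move=> [mX _ _ _ gen] uF psi0 Gpsi e0.
pose K := \sum_(j <- F) psi j.
have K0 : 0 <= K by rewrite /K big_seq sumr_ge0.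
(* The error on each transition gets weighted by [psi], of total [K]; the 1 keeps the denominator
   positive. *)
have e'0 : 0 < e / (K + 1) by rewrite divr_gt0// ltr_pwDr.
have [delta delta0 Hdelta] := has_generator_uniform F gen e'0.
exists delta => // t h t0 hdelta; have [h0 _] := andP hdelta.
have th0 : 0 <= t + h by rewrite addr_ge0// ltW.
set f := fun i => fine (P [set w | X t w = i]).
have f0 i : 0 <= f i by exact: fine_ge0.
have f1 : \sum_(i <- F) f i <= 1.
  have := @sum_fiber_le (X t) F setT (fun i => mX t i t0) measurableT uF.
  rewrite probability_setT /=; congr (_ <= _).
  by apply: eq_bigr => i _; rewrite setTI.
have lower j : j \in F ->
    \sum_(i <- F) f i * ((i == j)%:R + G i j * h - e / (K + 1) * h) <=
    fine (P [set w | X (t + h) w = j]).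
  move=> jF.
  have := @sum_fiber_le (X t) F _ (fun i => mX t i t0) (mX _ j th0) uF.
  apply: le_trans; rewrite big_seq [leRHS]big_seq; apply: ler_sum => i iF.
  have := Hdelta _ _ iF jF t h t0 hdelta.
  rewrite (_ : [set w | X t w = i /\ X (t + h) w = j] =
    [set w | X (t + h) w = j] `&` [set w | X t w = i]); last exact: setIC.
  by rewrite ler_norml -/(f i) => /andP[+ _]; lra.
apply: (le_trans _ (_ : \sum_(j <- F)
    (\sum_(i <- F) f i * ((i == j)%:R + G i j * h - e / (K + 1) * h)) * psi j <= _)).
  under [leRHS]eq_bigr do rewrite mulr_suml.
  rewrite [leRHS]exchange_big /=.
  have E1 i : i \in F -> f i * psi i - f i * (e * h) <=
      \sum_(j <- F) f i * ((i == j)%:R + G i j * h - e / (K + 1) * h) * psi j.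
    move=> iF.
    have -> : \sum_(j <- F) f i * ((i == j)%:R + G i j * h - e / (K + 1) * h) * psi j
       = f i * (psi i + h * (\sum_(j <- F) G i j * psi j) - e / (K + 1) * h * K).
      have -> : psi i = \sum_(j <- F) (i == j)%:R * psi j.
        rewrite (bigD1_seq i)//= eqxx mul1r big1 ?addr0// => j /negbTE ji.
        by rewrite eq_sym ji mul0r.
      rewrite /K !big_distrr /= -big_split -sumrB big_distrr /=.
      by apply: eq_bigr => j _; ring.
    rewrite -mulrBr ler_wpM2l// lerB//.
      by rewrite ler_wpDr// mulr_ge0 ?Gpsi// ltW.
    rewrite mulrAC ler_wpM2r ?(ltW h0)// mulrAC ler_pdivrMr ?ltr_pwDr//.
    by rewrite ler_wpM2l ?(ltW e0)// lerDl.
  apply: (le_trans _ (_ : \sum_(i <- F) (f i * psi i - f i * (e * h)) <= _)).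
    rewrite sumrB -mulr_suml lerD2l lerN2 ler_piMl// mulr_ge0// ltW//.
  by rewrite big_seq [leRHS]big_seq; apply: ler_sum => i iF; exact: E1.
rewrite big_seq [leRHS]big_seq; apply: ler_sum => j jF.
by rewrite ler_wpM2r ?psi0 ?lower.
Qed.

(* Only transitions inside F are controlled, which bounds the probabilities   *)
(* of the chain from below; hence the passage to K - phi.                     *)
Lemma superharmonic_expectation_le F (phi : E -> R) (t : R) :
  is_markov_chain P X G x0 -> uniq F -> x0 \in F ->
  (forall i, i \in F -> 0 <= \sum_(j <- F) G i j) ->
  (forall i, i \in F -> 0 <= phi i) ->
  (forall i, i \in F -> \sum_(j <- F) G i j * phi j <= 0) ->
  0 <= t ->
  \sum_(i <- F) fine (P [set w | X t w = i]) * phi i <= phi x0.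
Proof.
move=> chain uF x0F G0 phi0 Gphi t0.
have [mX _ X0 _ _] := chain.
pose K := \sum_(j <- F) phi j.
have phiK i : i \in F -> phi i <= K.
  move=> iF; rewrite /K (bigD1_seq i)//= ler_wpDr// big_seq_cond sumr_ge0// => j.
  by move=> /andP[jF _]; exact: phi0.
have K0 : 0 <= K by rewrite /K big_seq sumr_ge0.
pose psi i := K - phi i.
have psi0 i : i \in F -> 0 <= psi i by move=> iF; rewrite subr_ge0 phiK.
have Gpsi i : i \in F -> 0 <= \sum_(j <- F) G i j * psi j.
  move=> iF; under eq_bigr do rewrite mulrBr.
  rewrite sumrB -mulr_suml subr_ge0 (le_trans (Gphi _ iF))//.
  by rewrite mulr_ge0 ?G0.
pose w s := \sum_(i <- F) fine (P [set w | X s w = i]) * psi i.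
have w0 : psi x0 <= w 0.
  rewrite /w (bigD1_seq x0)//= X0 mul1r ler_wpDr// big_seq_cond sumr_ge0// => j.
  by move=> /andP[jF _]; rewrite mulr_ge0 ?psi0// fine_ge0.
have wt : psi x0 <= w t.
  apply: le_trans w0 _; apply/ler_addgt0Pr => e e0.
  (* Steps of length [t / n.+1 < delta] lose in total at most [e / (t + 1) * t <= e]. *)
  have et0 : 0 < e / (t + 1) by rewrite divr_gt0// ltr_pwDr.
  have [delta delta0 step] := subharmonic_increment chain uF psi0 Gpsi et0.
  have [n tn] : exists n : nat, t / delta < n.+1%:R.
    exists (Num.truncn (t / delta)); exact: truncnS_gt.
  have h0 : 0 <= t / n.+1%:R by rewrite divr_ge0.
  have hdelta : t / n.+1%:R < delta.
    by rewrite ltr_pdivrMr ?ltr0n// mulrC -ltr_pdivrMr.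
  have [->|tn0] := eqVneq t 0; first by rewrite ler_wpDr// ltW.
  have h1 : 0 < t / n.+1%:R by rewrite divr_gt0// lt0r tn0.
  have iterate m :
      w 0 - e / (t + 1) * (m%:R * (t / n.+1%:R)) <= w (m%:R * (t / n.+1%:R)).
    elim: m => [|m IHm]; first by rewrite mul0r mulr0 subr0.
    have := step (m%:R * (t / n.+1%:R)) (t / n.+1%:R).
    rewrite mulr_ge0// h1 hdelta => /(_ isT isT).
    rewrite -[m.+1%:R]natr1 mulrDl mul1r => stepm.
    apply: le_trans stepm; rewrite mulrDr opprD addrA lerD2r//.
  have := iterate n.+1; rewrite [n.+1%:R * _]mulrC divfK ?pnatr_eq0// => wle.
  rewrite -lerBlDr (le_trans _ wle)// lerD2l lerN2.
  by rewrite mulrAC ler_pdivrMr ?ltr_pwDr// ler_wpM2l ?(ltW e0)// lerDl.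
(* Going back to [phi]: the mass in [F] is at most 1, so the expectation of [phi] is at most
   [K - w t <= K - psi x0 = phi x0]. *)
have f1 : \sum_(i <- F) fine (P [set w | X t w = i]) <= 1.
  have := @sum_fiber_le (X t) F setT (fun i => mX t i t0) measurableT uF.
  rewrite probability_setT /=; congr (_ <= _).
  by apply: eq_bigr => i _; rewrite setTI.
have : w t = K * \sum_(i <- F) fine (P [set w | X t w = i]) -
    \sum_(i <- F) fine (P [set w | X t w = i]) * phi i.
  by rewrite mulrC big_distrl -sumrB; apply: eq_bigr => i _; rewrite -mulrBr.
have := ler_wpM2l K0 f1.
by move: wt; rewrite /psi; lra.
Qed.

End supermartingale.

(** * Events about the path after a given time *)

Section eventually_constant.
Context {R : realType} {d : measure_display} {T : measurableType d}.
Context {E : choiceType}.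
Variables (P : probability T R) (X : R -> T -> E).
Hypothesis mX : forall t i, 0 <= t -> measurable [set w | X t w = i].

Lemma probability_le_sum_fiber (t : R) (F : seq E) (B : set T) : 0 <= t ->
  measurable B -> (forall w, B w -> X t w \in F) ->
  fine (P B) <= \sum_(i <- F) fine (P [set w | X t w = i]).
Proof.
move=> t0; elim: F B => [|a F IH] B mB BF.
  rewrite big_nil (_ : B = set0) ?measure0//.
  by apply/seteqP; split=> w // /BF.
have mI : measurable (B `&` [set w | X t w = a]) by exact: measurableI (mX a t0).
have mD : measurable (B `\` [set w | X t w = a]) by exact: measurableD (mX a t0).
rewrite big_cons (measureDI P mB (mX a t0)) fineD ?fin_num_measure//.
rewrite addrC lerD//.
  apply: fine_le; rewrite ?fin_num_measure//; [exact: mX|].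
  by apply: le_measure; rewrite ?inE//; exact: mX.
apply: IH => //.
by move=> w [/BF]; rewrite inE => /orP[/eqP|].
Qed.

Hypothesis rcX : forall w t, 0 <= t -> exists2 e : R, 0 < e &
  forall s, t <= s < t + e -> X s w = X t w.

(** By right-continuity it is enough to test the rational times, of which there are countably
    many. *)
Lemma measurable_constant_from (a : R) (i : E) : 0 <= a ->
  measurable [set w | forall t, a <= t -> X t w = i].
Proof.
move=> a0.
rewrite (_ : mkset _ = ~` \bigcup_(q : rat)
    (if a <= ratr q then ~` [set w | X (ratr q) w = i] else set0)).
  apply: measurableC; apply: bigcupT_measurable_rat => q; case: ifP => // aq.
  by apply: measurableC; apply: mX; exact: le_trans aq.
apply/seteqP; split => w /=.
  by move=> Xi [q _]; case: ifP => // aq; apply; exact: Xi.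
move=> nq t at_; have [e e0 Xt] := rcX w (le_trans a0 at_).
have /rat_in_itvoo[q] : t < t + e by rewrite ltrDl.
rewrite in_itv /= => /andP[tq qt].
rewrite -(Xt (ratr q)) ?(ltW tq)//; apply: contrapT => Xq; apply: nq.
by exists q => //; rewrite (le_trans at_ (ltW tq)).
Qed.

End eventually_constant.

(** * The generator on configurations of bounded mass *)

Section arw.
Context {R : realType} {N : nat}.
Implicit Types (x : box N) (eta xi : config N).

Definition mass eta : nat := (\sum_x nparticles (eta x))%N.

(** A finite list closed under the dynamics. A site holds at most [M] particles, so codes in
    [option 'I_M.+1], with [None] for a sleeper, reach every such configuration. *)
Definition configs_of_mass_le (M : nat) : seq (config N) :=
  [seq eta <- undup [seq [ffun x => site_decode (omap val (f x))]
                    | f : {ffun box N -> option 'I_M.+1}]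
  | (mass eta <= M)%N].

Lemma mem_configs_of_mass_le M eta :
  (eta \in configs_of_mass_le M) = (mass eta <= M)%N.
Proof.
rewrite mem_filter andb_idr// => etaM; rewrite mem_undup.
apply/mapP; exists [ffun x => omap inord (site_code (eta x))].
  by rewrite mem_enum.
apply/ffunP => x; rewrite !ffunE.
have : (nparticles (eta x) <= M)%N.
  by apply: leq_trans etaM; rewrite /mass (bigD1 x)//= leq_addr.
by case: (eta x) => //= k kM; rewrite inordK.
Qed.

Lemma massE eta : (mass eta)%:Z = \sum_x occupation eta x.
Proof.
rewrite /mass -[LHS]natz natr_sum; apply: eq_bigr => x _.
by rewrite ffunE natz.
Qed.

Lemma mass_move x e eta : (0 < nactive (eta x))%N -> e != 0 ->
  (mass (Defs.move x e eta) <= mass eta)%N.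
Proof.
move=> xact e0; rewrite -lez_nat !massE occupation_move//.
under eq_bigr do rewrite ffunE.
by rewrite big_split /= gerDl sum_jump subr_le0 lez_nat leq_b1.
Qed.

Lemma mass_sleep x eta : (0 < nactive (eta x))%N ->
  mass (Defs.sleep x eta) = mass eta.
Proof.
move=> /sleepE[->//|[occE _]]; apply/eqP.
by rewrite -eqz_nat !massE occE.
Qed.

Lemma mass_stable eta : stable eta -> (mass eta <= #|{: box N}|)%N.
Proof.
move=> /forallP stab; rewrite -sum1_card; apply: leq_sum => x _.
by have := stab x; case: (eta x) => [k|] //= /eqP ->.
Qed.

Lemma uniq_configs_of_mass_le M : uniq (configs_of_mass_le M).
Proof. by rewrite filter_uniq ?undup_uniq. Qed.

Lemma unit_steps_neq0 e : e \in unit_steps -> e != 0.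
Proof. by rewrite !inE => /or4P[] /eqP ->. Qed.

(** Every transition from a configuration in the list stays in it, so the truncated sum is the full
    action of the generator. *)
Lemma arw_generator_apply (lambda : R) M (phi : config N -> R) eta :
  (mass eta <= M)%N ->
  \sum_(xi <- configs_of_mass_le M) arw_generator lambda eta xi * phi xi =
  \sum_x (nactive (eta x))%:R *
    (\sum_(e <- unit_steps) (phi (Defs.move x e eta) - phi eta) / 4 +
     lambda * (phi (Defs.sleep x eta) - phi eta)).
Proof.
move=> etaM; set F := configs_of_mass_le M.
have uF : uniq F := uniq_configs_of_mass_le M.
have etaF : eta \in F by rewrite mem_configs_of_mass_le.
have moveF x e : (0 < nactive (eta x))%N -> e \in unit_steps -> Defs.move x e eta \in F.
  move=> xact eunit; rewrite mem_configs_of_mass_le (leq_trans _ etaM)//.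
  by rewrite mass_move// unit_steps_neq0.
have sleepF x : (0 < nactive (eta x))%N -> Defs.sleep x eta \in F.
  by move=> xact; rewrite mem_configs_of_mass_le mass_sleep.
have pick zeta : zeta \in F ->
    \sum_(xi <- F) ((zeta == xi)%:R - (eta == xi)%:R) * phi xi = phi zeta - phi eta.
  move=> zF.
  have one z : z \in F -> \sum_(xi <- F) (z == xi)%:R * phi xi = phi z.
    move=> {}zF; rewrite (bigD1_seq z)//= eqxx mul1r big1 ?addr0// => j /negbTE jz.
    by rewrite eq_sym jz mul0r.
  by under eq_bigr do rewrite mulrBl; rewrite sumrB !one.
rewrite /arw_generator.
under eq_bigr do rewrite big_distrl /=.
rewrite exchange_big /=; apply: eq_bigr => x _.
have [x0|xact] := posnP (nactive (eta x)).
  rewrite x0 [RHS]mul0r big1// => xi _.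
  rewrite big1 => [|e _]; last by rewrite mul0r mul0r.
  by rewrite mulr0 mul0r addr0 mul0r.
under eq_bigr do rewrite mulrDl big_distrl /=.
rewrite big_split exchange_big /= mulrDr big_distrr /=; congr (_ + _).
  rewrite big_seq [RHS]big_seq; apply: eq_bigr => e eunit.
  under eq_bigr do rewrite -[_ * phi _]mulrA.
  by rewrite -mulr_sumr pick ?moveF//; ring.
under eq_bigr do rewrite -[_ * phi _]mulrA.
by rewrite -mulr_sumr pick ?sleepF//; ring.
Qed.

Lemma stabilizes_to_inj (path : R -> config N) xi xi' :
  stabilizes_to path xi -> stabilizes_to path xi' -> xi = xi'.
Proof.
move=> [_ [t0 _ pathE]] [_ [t1 _ pathE']].
by rewrite -(pathE (Num.max t0 t1)) ?le_max ?lexx// pathE'// le_max lexx orbT.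
Qed.

End arw.

(** * Tail bound for the number of sleepers *)

Section stabilization.
Context {R : realType} {N : nat} {d : measure_display}.
Context {Omega : measurableType d} (P : probability Omega R).
Variables (lambda : R) (eta0 : {ffun box N -> nat}) (eta : R -> Omega -> config N).
Hypothesis lambda0 : 0 < lambda.
Hypothesis eta0_le : (\sum_(x : box N) eta0 x <= #|{: box N}|)%N.
Hypothesis chain : is_markov_chain P eta (arw_generator lambda) (all_active eta0).

Let F := configs_of_mass_le (N := N) #|{: box N}|.

Lemma expectation_lyapunov_le (t : R) : 0 <= t ->
  \sum_(xi <- F) fine (P [set w | eta t w = xi]) * lyapunov lambda xi
    <= 8 ^+ #|{: box N}|.
Proof.
move=> t0; apply: le_trans (lyapunov_all_active lambda eta0).
apply: (superharmonic_expectation_le chain) => //.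
- exact: uniq_configs_of_mass_le.
- rewrite mem_configs_of_mass_le (leq_trans _ eta0_le)//.
  by apply: leq_sum => x _; rewrite ffunE.
- move=> xi; rewrite mem_configs_of_mass_le => xiF.
  rewrite -[leRHS](_ : \sum_(j <- F) arw_generator lambda xi j * 1 = _).
    rewrite (arw_generator_apply _ (fun=> 1))//.
    apply: sumr_ge0 => x _; rewrite subrr mulr0 addr0 big1 ?mulr0// => e _.
    by rewrite mul0r.
  by under eq_bigr do rewrite mulr1.
- by move=> xi _; exact: lyapunov_ge0.
- move=> xi; rewrite mem_configs_of_mass_le => xiF.
  rewrite arw_generator_apply//; apply: sumr_le0 => x _.
  have [->|xact] := posnP (nactive (xi x)); first by rewrite mul0r.
  by rewrite mulr_ge0_le0// lyapunov_superharmonic.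
Qed.

Variable theta : R.
Hypothesis theta0 : 0 < theta.

(** Integer times and finitely many limits make these events measurable and increasing in [n]. *)
Definition settled (n : nat) : set Omega :=
  \bigcup_(xi in [set` [seq xi <- F | stable xi & theta <= (num_sleeping xi)%:R]])
    [set w | forall t, n%:R <= t -> eta t w = xi].

Lemma measurable_settled n : measurable (settled n).
Proof.
have [mX rcX _ _ _] := chain.
apply: fin_bigcup_measurable => [|xi _]; first exact: finite_seq.
exact: measurable_constant_from.
Qed.

(** A path that never stabilizes counts no sleepers by convention; as [theta] is positive, it lies
    in neither set. *)
Lemma final_sleeping_settled :
  [set w | theta <= (final_sleeping (eta ^~ w))%:R] = \bigcup_n settled n.
Proof.
apply/seteqP; split => [w|w [n _ [xi]]] /=.
  have [[xi xiw]|nstab] := pselect (exists xi, stabilizes_to (eta ^~ w) xi).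
    rewrite /final_sleeping (xget_subset1 _ xiw) => [thetale|xi' xi'']; last first.
      exact: stabilizes_to_inj.
    have [stab [t0 t00 pathE]] := xiw.
    exists (Num.truncn t0).+1 => //; exists xi.
      by rewrite /= mem_filter stab thetale mem_configs_of_mass_le mass_stable.
    move=> t nt; apply: pathE; apply: le_trans nt.
    by rewrite ltW// truncnS_gt.
  rewrite /final_sleeping xgetPN => [|xi xiw]; last by apply: nstab; exists xi.
  rewrite (_ : num_sleeping _ = 0%N) ?leNgt ?theta0//.
  by apply: eq_card0 => x; rewrite !inE ffunE.
rewrite /= mem_filter => /andP[/andP[stab thetale] _] pathE.
have xiw : stabilizes_to (eta ^~ w) xi by split=> //; exists n%:R.
rewrite /final_sleeping (xget_subset1 _ xiw)// => xi' xi''.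
exact: stabilizes_to_inj.
Qed.

(** Markov's inequality at time [n]: on [settled n] the state is already stable with at least
    [theta] sleepers, so [lyapunov] is there at least lambda^(-theta) >= e^a. *)
Lemma measure_settled_le n (lambda1 : lambda < 1) (a : R) :
  a <= theta * ln lambda^-1 ->
  fine (P (settled n)) <= expR (- a) * 8 ^+ #|{: box N}|.
Proof.
move=> alam; have [mX _ _ _ _] := chain.
set bad := [seq xi <- F | stable xi & theta <= (num_sleeping xi)%:R].
have := @probability_le_sum_fiber _ _ _ _ P eta mX n%:R bad (settled n).
move=> /(_ (ler0n _ _) (measurable_settled n)) le1.
apply: le_trans (le1 _) _ => [w [xi xibad /(_ _ (lexx _)) ->]//|].
rewrite mulrC -ler_pdivrMr ?expR_gt0// expRN invrK.
apply: le_trans (expectation_lyapunov_le (ler0n R n)).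
rewrite mulr_suml /bad big_filter big_mkcond; apply: ler_sum => xi _.
case: ifPn => [/andP[stab thetale]|_]; last first.
  by rewrite mulr_ge0 ?lyapunov_ge0 ?fine_ge0.
rewrite ler_wpM2l ?fine_ge0//.
apply: le_trans (lyapunov_stable lambda0 stab).
rewrite -[lambda^-1]lnK ?posrE ?invr_gt0// -expRM_natl ler_expR.
apply: le_trans alam _; rewrite ler_wpM2r// ln_ge0// invf_ge1 ?ltW//.
Qed.

End stabilization.

Theorem theorem1p4 (R : realType) :
  exists C c : R, 0 < C /\ 0 < c /\
  forall (lambda : R), 0 < lambda < 1 ->
  forall (N : nat), (0 < N)%N ->
  forall (eta0 : {ffun box N -> nat}),
    (\sum_(x : box N) eta0 x <= #|{: box N}|)%N ->
  forall (d : measure_display) (Omega : measurableType d)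
    (P : probability Omega R) (eta : R -> Omega -> config N),
    is_markov_chain P eta (arw_generator lambda) (all_active eta0) ->
    (P [set w | (C / ln lambda^-1 * #|{: box N}|%:R
                 <= (final_sleeping (eta ^~ w))%:R)%R]
     <= (expR (- c * N%:R ^+ 2))%:E)%E.
Proof.
(* With V = (2N+1)^2 sites, C = 4 gives e^(-4V) 8^V <= e^(-4V + 3V) = e^(-V), and V >= N^2 allows c
   = 1. *)
exists 4, 1; split=> //; split=> // lambda /andP[l0 l1] N N0 eta0 eta0le.
move=> d Omega P eta chain.
set V := #|{: box N}|.
have VE : V = (N.*2.+1 * N.*2.+1)%N by rewrite /V card_prod !card_ord.
have L0 : 0 < ln lambda^-1 by rewrite ln_gt0// invf_gt1.
have V0 : 0 < V%:R :> R by rewrite ltr0n VE.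
have theta0 : 0 < 4 / ln lambda^-1 * V%:R by rewrite mulr_gt0// divr_gt0.
rewrite (final_sleeping_settled eta theta0).
set B := settled _ _.
have mB n : measurable (B n) by exact: measurable_settled chain _ n.
have Bincr : nondecreasing_seq B.
  move=> m n mn; apply/subsetPset => w [xi xibad pathE]; exists xi => // t nt.
  by apply: pathE; apply: le_trans nt; rewrite ler_nat.
(* Continuity from below: a bound valid for every [n] passes to the union. *)
have PB := @nondecreasing_cvg_mu _ _ _ P _ mB (bigcupT_measurable _ mB) Bincr.
rewrite -(cvg_lim _ PB)//; apply: lime_le; first exact: cvgP PB.
apply: nearW => n /=; rewrite -[P (B n)]fineK ?fin_num_measure// lee_fin.
apply: le_trans (measure_settled_le l0 eta0le chain n l1 (a := 4 * V%:R) _) _.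
  by rewrite mulrAC divfK ?gt_eqF.
have e8 : 8 ^+ V <= expR (3 * V%:R) :> R.
  rewrite mulrC expRM_natl lerXn2r ?nnegrE ?expR_ge0//.
  have e2 : 2 <= expR 1 :> R by have := @expR_ge1Dx R 1; lra.
  rewrite -[3]mulr1 expRM_natl (_ : 8 = 2 ^+ 3); last by ring.
  by rewrite lerXn2r ?nnegrE ?expR_ge0.
apply: le_trans (ler_wpM2l (expR_ge0 _) e8) _.
rewrite -expRD ler_expR mulN1r -mulNr -mulrDl.
have -> : - 4 + 3 = -1 :> R by ring.
rewrite mulN1r lerN2 -natrX ler_nat VE; lia.
Qed.
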